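(* For every convex geometry $\mathcal{L}$ on a finite set $E$ there is a map $\mathcal{F}:E\to\mathrm{Poly}_2$ assigning to each element of $E$ a convex polygon in $\mathbb{R}^2$ such that $\mathcal{L}=\{\emptyset\}\cup\{X\subseteq E:\ \forall y\in E,\ \mathcal{F}(y)\subseteq\mathrm{Hull}(\mathcal{F}(X))\Rightarrow y\in X\}$, where $\mathcal{F}(X)=\bigcup_{x\in X}\mathcal{F}(x)$ and $\mathrm{Hull}$ denotes the convex hull. That is, every convex geometry can be embedded as convex polygons in $\mathbb{R}^2$.
   Context: A convex geometry on a finite set $E$ is a family $\mathcal{L}$ of subsets of $E$ with $\emptyset,E\in\mathcal{L}$, closed under intersection, and such that for every $X\in\mathcal{L}\setminus\{E\}$ there is $e\in E\setminus X$ with $X\cup\{e\}\in\mathcal{L}$. $\mathrm{Poly}_2$ denotes the set of convex polygons in $\mathbb{R}^2$, i.e. convex hulls of nonempty finite sets of points of $\mathbb{R}^2$ (degenerate polygons such as segments allowed). *)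

(* Defs.v *)
From mathcomp Require Import all_boot all_order all_algebra.
From mathcomp Require Import boolp classical_sets cardinality reals convex.

Set Implicit Arguments.
Unset Strict Implicit.
Unset Printing Implicit Defensive.

Local Open Scope classical_set_scope.

Record convex_geometry (E : finType) (L : {set {set E}}) : Prop := {
  convex_geometry0 : finset.set0 \in L;
  convex_geometryT : [set: E]%SET \in L;
  convex_geometryI : {in L &, forall X Y, (X :&: Y)%SET \in L};
  convex_geometry_extend :
    {in L, forall X, X != [set: E]%SET ->
      exists2 e, e \notin X & (e |: X)%SET \in L} }.

Definition hull (R : realType) (V : lmodType R) (A : set V) : set V :=
  smallest (@convex_set R V) A.

(* Nonemptiness matters: an empty polygon would lie in every hull.  Points and
   segments are allowed. *)
Definition Poly2 (R : realType) : set (set 'rV[R]_2) :=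
  [set P | exists S : set 'rV[R]_2,
     [/\ finite_set S, S !=set0 & P = hull S]].

Definition polygon_union (R : realType) (E : finType)
    (F : E -> set 'rV[R]_2) (X : {set E}) : set 'rV[R]_2 :=
  \bigcup_(x in [set` X]) F x.

(* Main.v *)
Require Import Defs.
From mathcomp Require Import all_boot all_order all_algebra.
From mathcomp Require Import boolp classical_sets cardinality reals convex.
From mathcomp Require Import ring lra interval_inference.

(** Attach to each closed set [Z] a point [q_Z] of the parabola [v = u ^ 2], and
    let [F x] be the hull of the points [q_Z] for the closed sets [Z] avoiding
    [x].  Points of a parabola are in strictly convex position, so [q_Z] lies in
    the hull of [F(X)] exactly when some element of [X] lies outside [Z].  Thus
    [F y] is contained in the hull of [F(X)] iff every closed set containing [X]
    contains [y].  Since the empty set is closed, its point belongs to every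
    [F x], which is therefore nonempty. *)

Import Order.TTheory GRing.Theory Num.Theory.

Local Open Scope classical_set_scope.

Section Hull.
Context {R : realType} {V : lmodType R}.
Implicit Types A B : set V.

Lemma subset_hull A : A `<=` hull A.
Proof. exact: sub_gen_smallest. Qed.

Lemma hull_min A B : @convex_set R V B -> A `<=` B -> hull A `<=` B.
Proof. exact: smallest_sub. Qed.

Lemma convex_hull A : @convex_set R V (hull A).
Proof.
move=> x y k; rewrite !inE => Ax Ay B [Bcvx AB].
by apply/set_mem/Bcvx; rewrite inE; [apply: Ax|apply: Ay].
Qed.

Lemma convex_open_halfspace (f : V -> R) (c : R) :
  scalar f -> @convex_set R V [set v | c < f v]%R.
Proof.
move=> flin; apply/convex_setW => x y; rewrite !inE /= => fx fy k k0 k1.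
rewrite inE /=.
have -> : conv k x y = (k%:num *: (x : V) + (1 - k%:num) *: (y : V))%R by [].
have f0 : f 0%R = 0%R.
  by have := flin (-1)%R 0%R 0%R; rewrite scaler0 addr0 mulN1r addNr.
(* [flin] only expands terms [a *: u + v]; the added zero lets it split the second scaled vector. *)
rewrite flin -[X in (_ < _ + f X)%R]addr0 flin f0 addr0.
by nra.
Qed.

End Hull.

Section Parabola.
Context {R : realType}.
Implicit Types t u : R.

Definition parabola t : 'rV[R]_2 := (\row_j t ^+ j.+1)%R.

Lemma parabola_notin_hull t (A : set R) :
  ~ A t -> ~ hull (parabola @` A) (parabola t).
Proof.
move=> nAt.
(* [f] is constant along the tangent at [t], so on the parabola it is minimal at
   [t] only. *)
pose f (v : 'rV[R]_2) := (v ord0 1 - 2 * t * v ord0 0)%R.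
have fE u : f (parabola u) = ((u - t) ^+ 2 - t ^+ 2)%R.
  by rewrite /f !mxE /=; ring.
have flin : scalar f by move=> a u v; rewrite /f !mxE; ring.
suff /[apply] : hull (parabola @` A) `<=` [set v | f (parabola t) < f v]%R.
  by rewrite /= ltxx.
apply: hull_min; first exact: convex_open_halfspace.
move=> _ [u Au <-] /=; rewrite !fE subrr expr0n /= ltrD2r.
by rewrite exprn_even_gt0 // subr_eq0; apply/eqP => ut; apply: nAt; rewrite -ut.
Qed.

End Parabola.

Theorem theorem5 (R : realType) (E : finType) (L : {set {set E}})
    (hL : convex_geometry L) :
  exists F : E -> set 'rV[R]_2,
    (forall x : E, Poly2 (F x)) /\
    [set` L] =
      [set finset.set0] `|`
      [set X : {set E} |
        forall y : E, F y `<=` hull (polygon_union F X) -> y \in X].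
Proof.
have [L0 LT LI _] := hL.
(* Only injectivity of [t] matters: distinct sets get distinct points. *)
pose t (Z : {set E}) : R := ((enum_rank Z)%:R)%R.
have t_inj : injective t.
  by move=> Y Z /eqP; rewrite eqr_nat => /eqP /val_inj /enum_rank_inj.
pose avoiding x : set {set E} := [set Z | Z \in L /\ x \notin Z].
pose vertices x := parabola @` (t @` avoiding x).
exists (fun x => hull (vertices x)); split=> [x|].
  exists (vertices x); split=> //.
    by do 2!apply: finite_image; apply: finite_finset.
  by exists (parabola (t finset.set0)); do 2!apply: imageP; split; rewrite ?inE.
apply/seteqP; split=> X /=.
- move=> XL; right=> y; apply: contraPP => /negP yX sub.
  have /sub q_in : hull (vertices y) (parabola (t X)).
    by apply: subset_hull; do 2!apply: imageP.
  (* Parameters of all vertices attached to elements of [X]; [t X] is not among them, as no [x] in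
     [X] avoids [X]. *)
  pose A := t @` [set Z | exists2 x, x \in X & avoiding x Z].
  apply: (@parabola_notin_hull _ (t X) A).
    by case=> Z [x xX [_ xZ]] /t_inj ZX; rewrite ZX xX in xZ.
  apply: hull_min q_in; first exact: convex_hull.
  move=> v [x /= xX]; apply: hull_min; first exact: convex_hull.
  apply: subset_trans (@subset_hull _ _ _).
  by do 2!apply: image_subset; move=> Z; exists x.
- case=> [->//|Xcl].
  (* The right side is the closure of [X], closed by [LT] and [LI]. *)
  suff defX : X = (\bigcap_(Z in L | X \subset Z) Z)%SET.
    by rewrite defX; apply: (big_ind (fun Y => Y \in L)) => // Z /andP[].
  apply/eqP; rewrite finset.eqEsubset; apply/andP; split.
    by apply/bigcapsP => Z /andP[].
  apply/fintype.subsetP => y /finset.bigcapP yC; apply: Xcl.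
  apply: hull_min; first exact: convex_hull.
  (* A vertex for [y] comes from a closed [Z] missing [y], hence not containing [X], so some [x] in
     [X] shares that vertex. *)
  move=> _ [_ [Z [ZL yZ] <-] <-].
  have /subsetPn[x xX xZ] : ~~ (X \subset Z).
    by apply: contraNN yZ => XZ; apply: yC; rewrite ZL.
  apply: subset_hull; exists x => //.
  by apply: subset_hull; do 2!apply: imageP.
Qed.
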